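(* Let $f=(f_1,\dots,f_{n_x}):\mathcal Z\to\mathbb R^{n_x}$ be an ELLC vector field with known Clarke-derivative bounds $a_{ij},b_{ij}$. Then the inclusion function $T^{f_d}_R$ converges to the tightest inclusion function $T^f_O$ with convergence rate $1$: there is $\beta^f_R>0$ such that for all intervals $\mathbb I\mathcal Z\subset\mathcal Z$, $$\underline q_{f_d}(\mathbb I\mathcal Z)=q(T_R^{f_d}(\mathbb I\mathcal Z),T_O^f(\mathbb I\mathcal Z))\le\beta^f_R\,d(\mathbb I\mathcal Z).$$ Moreover, the subdivision principle applies: for each interval $\mathbb I\mathcal Z\subset\mathcal Z$ there is $\gamma^f_R>0$ such that for all $k\in\mathbb N$, $$q(T_R^{f_d}(\mathbb I\mathcal Z;k),T_O^f(\mathbb I\mathcal Z;k))\le\frac{\gamma_R^f}{k},$$ where $\mathbb I\mathcal Z$ is subdivided into $k^{n_z}$ intervals $\mathbb I\mathcal Z^l$, $l\in\mathbb N_{k^{n_z}}$, with $k$ equal divisions in each dimension (so $d(\mathbb I\mathcal Z^l_j)=d(\mathbb I\mathcal Z_j)/k$ for all $j$), $T_R^{f_d}(\mathbb I\mathcal Z;k)=\bigcup_{l}T_R^{f_d}(\mathbb I\mathcal Z^l)$ and $T_O^f(\mathbb I\mathcal Z;k)=\bigcup_l T_O^f(\mathbb I\mathcal Z^l)$.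
   Context: Notation: $\mathbb N_n=\{1,\dots,n\}$; inequalities between vectors are componentwise; an interval is $\mathbb I\mathcal Z=[\underline z,\overline z]=\{z:\underline z\le z\le\overline z\}$ and $d(\mathbb I\mathcal Z)=\|\overline z-\underline z\|_\infty$. $\mathcal Z\subset\mathbb R^{n_z}$ is a box (product of intervals). Topological notions are relative to $\mathcal Z$, and difference quotients use points of $\mathcal Z$. The system is $x_t^+=f(z_t)$, $z_t=(x_t,w_t)\in\mathcal Z$, $n_x\le n_z$, either discrete-time (DT, $x_t^+=x_{t+1}$) or continuous-time (CT, $x_t^+=\dot x_t$). In the CT case, for component $i$ the interval argument is replaced everywhere by the interval with the same $j$-th coordinates, $j\ne i$, and with $\underline z_i=\overline z_i=x_i$ a fixed value. ELLC: $\varphi:\mathcal Z\to\mathbb R$ is either-sided locally Lipschitz continuous if for every $z\in\mathcal Z$ there are an open neighborhood $\mathcal N_z$ of $z$, a vector $\kappa\in\mathbb R^{n_z}$ with all entries nonzero, and $\rho\in\mathbb R$ such that $\langle\kappa(\varphi(z')-\varphi(z'')),z'-z''\rangle\le\rho\|z'-z''\|_2^2$ for all $z',z''\in\mathcal N_z$. A vector field is ELLC if each component is. Clarke derivatives: $(\overline J^{\varphi}_C(z))_j=\limsup_{t\to z,\lambda\downarrow0}\frac{\varphi(t+\lambda e_j)-\varphi(t)}{\lambda}$ and $(\underline J^{\varphi}_C(z))_j=\liminf_{t\to z,\lambda\downarrow0}\frac{\varphi(t+\lambda e_j)-\varphi(t)}{\lambda}$, with $e_j$ the $j$-th standard unit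 vector. Bounds: $a_{ij}\in\mathbb R\cup\{-\infty\}$, $b_{ij}\in\mathbb R\cup\{+\infty\}$, not both infinite for any $(i,j)$, satisfy $a_{ij}\le(\underline J_C^{f_i}(z))_j$ and $(\overline J_C^{f_i}(z))_j\le b_{ij}$ for all $z\in\mathcal Z$. Put $p_{ij}=\min(a_{ij},0)$ and $r_{ij}=\max(b_{ij},0)$. DT: $\mathbf M_i^c=\{\mathbf m\in\mathbb R^{n_z}:\forall j,\ \mathbf m_j=r_{ij}\text{ or }\mathbf m_j=p_{ij}\}$; CT: the same with the condition imposed for $j\ne i$ only, and $\mathbf m_i=0$. Corner map: $\zeta_{i,\mathbf m,j}(z,\hat z)=\hat z_j$ if $\mathbf m_j\ge r_{ij}$, and $=z_j$ otherwise; in the CT case its $i$-th coordinate is $x_i$. Put $\zeta^+_{i,\mathbf m}=\zeta_{i,\mathbf m}(\overline z,\underline z)$ and $\zeta^-_{i,\mathbf m}=\zeta_{i,\mathbf m}(\underline z,\overline z)$. $T_R^{f_d}(\mathbb I\mathcal Z)$ is the interval vector with $i$-th component $[\max_{\mathbf m\in\mathbf M_i^c}\Delta^2_{i,\mathbf m},\ \min_{\mathbf m\in\mathbf M_i^c}\Delta^1_{i,\mathbf m}]$, where $\Delta^1_{i,\mathbf m}=f_i(\zeta^+_{i,\mathbf m})+\mathbf m^\top(\zeta^-_{i,\mathbf m}-\zeta^+_{i,\mathbf m})$ and $\Delta^2_{i,\mathbf m}=f_i(\zeta^-_{i,\mathbf m})-\mathbf m^\top(\zeta^-_{i,\mathbf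 m}-\zeta^+_{i,\mathbf m})$. $T_O^f(\mathbb I\mathcal Z)=[\underline f^{\rm true},\overline f^{\rm true}]$ is the tightest interval enclosing $f(\mathbb I\mathcal Z)$, with $\underline f^{\rm true}_i=\min_{\mathbb I\mathcal Z}f_i$, $\overline f_i^{\rm true}=\max_{\mathbb I\mathcal Z}f_i$ (infimum/supremum if not attained). Further, $\underline q_{f_d}(\mathbb I\mathcal Z)=\max_{i}\max\{\min_{\mathbf m\in\mathbf M^c_i}\Delta^1_{i,\mathbf m}-\overline f^{\rm true}_i,\ \underline f_i^{\rm true}-\max_{\mathbf m\in\mathbf M_i^c}\Delta^2_{i,\mathbf m}\}$. Metric: $q([\underline v,\overline v],[\underline w,\overline w])=\max_{i\in\mathbb N_{n_x}}\max\{|\overline v_i-\overline w_i|,|\underline v_i-\underline w_i|\}$; for unions of intervals, $q$ is evaluated on the smallest enclosing intervals. *)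

(* Defs.v *)
From HB Require Import structures.
From mathcomp Require Import all_boot all_order all_algebra.
From mathcomp Require Import all_classical all_reals all_analysis.

Set Implicit Arguments.
Unset Strict Implicit.
Unset Printing Implicit Defensive.

Import Order.TTheory GRing.Theory Num.Theory.
Import numFieldNormedType.Exports.

Local Open Scope classical_set_scope.
Local Open Scope ring_scope.

(* R^n is 'rV[R]_n, so every coordinate is written z 0 j.  A map defined on a
   domain D only is represented by a total function of which all the
   definitions below read nothing but the values on D. *)

Section vectors.
Context {R : realType} {n : nat}.
Implicit Types (u v z : 'rV[R]_n).

Definition dotv u v : R := \sum_j u 0 j * v 0 j.

Definition norm2 v : R := Num.sqrt (dotv v v).

Definition box (I : 'I_n -> interval R) : set 'rV[R]_n :=
  [set z | forall j, z 0 j \in I j].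

End vectors.

(* The pair (lower bound, upper bound) of an interval [lower, upper] of R^n. *)
Definition ivec (R : realType) (n : nat) : Type := ('rV[R]_n * 'rV[R]_n)%type.

Section intervals.
Context {R : realType} {n : nat}.
Implicit Types (V W : ivec R n).

Definition proper_ivec V : Prop := forall j, V.1 0 j <= V.2 0 j.

Definition points V : set 'rV[R]_n :=
  [set z | forall j, V.1 0 j <= z 0 j <= V.2 0 j].

(* The norm of 'rV[R]_n is the sup norm mx_norm. *)
Definition width V : R := `|V.2 - V.1|.

(* A maximum (minimum) over a nonempty finite family is written as the sup (inf)
   of its range, here and below. *)
Definition idist V W : R :=
  sup (range (fun i : 'I_n =>
    Num.max `|V.2 0 i - W.2 0 i| `|V.1 0 i - W.1 0 i|)).

(* The smallest interval enclosing a nonempty bounded set. *)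
Definition hull (A : set 'rV[R]_n) : ivec R n :=
  (\row_i inf [set z 0 i | z in A], \row_i sup [set z 0 i | z in A]).

(* The cells of the subdivision of V into k equal parts in each dimension are
   indexed by the k ^ n maps l : {ffun 'I_n -> 'I_k}. *)
Definition cell (k : nat) V (l : {ffun 'I_n -> 'I_k}) : ivec R n :=
  (\row_j (V.1 0 j + (l j)%:R * ((V.2 0 j - V.1 0 j) / k%:R)),
   \row_j (V.1 0 j + (l j).+1%:R * ((V.2 0 j - V.1 0 j) / k%:R))).

End intervals.

(* The set obtained by evaluating the interval map T on all the cells. *)
Definition subdivided {R : realType} {n m : nat} (T : ivec R n -> ivec R m)
    (k : nat) (V : ivec R n) : set 'rV[R]_m :=
  \bigcup_(l in [set: {ffun 'I_n -> 'I_k}]) points (T (cell V l)).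

Section regularity.
Context {R : realType} {n : nat}.
Implicit Types (D : set 'rV[R]_n) (phi : 'rV[R]_n -> R).

Definition ellc D phi : Prop :=
  forall z, D z ->
    exists (N : set 'rV[R]_n) (kappa : 'rV[R]_n) (rho : R),
      [/\ open N, N z, (forall j, kappa 0 j != 0) &
          forall z1 z2, (D `&` N) z1 -> (D `&` N) z2 ->
            dotv ((phi z1 - phi z2) *: kappa) (z1 - z2)
              <= rho * norm2 (z1 - z2) ^+ 2].

Definition diff_quotient phi (j : 'I_n) (p : 'rV[R]_n * R) : \bar R :=
  ((phi (p.1 + p.2 *: delta_mx 0 j) - phi p.1) / p.2)%:E.

(* t --> z and lambda --> 0, restricted to lambda > 0 and to difference
   quotients both of whose points lie in D; t = z is allowed.  If D is
   degenerate in direction j there is no such quotient, and the limsup and the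
   liminf over this filter are -oo and +oo. *)
Definition clarke_filter D (z : 'rV[R]_n) (j : 'I_n) :
    set_system ('rV[R]_n * R) :=
  within [set p | [/\ D p.1, 0 < p.2 & D (p.1 + p.2 *: delta_mx 0 j)]]
         (nbhs (z, 0 : R)).

Definition clarke_upper D phi z j : \bar R :=
  limf_esup (diff_quotient phi j) (clarke_filter D z j).

Definition clarke_lower D phi z j : \bar R :=
  limf_einf (diff_quotient phi j) (clarke_filter D z j).

End regularity.

Definition component {R : realType} {n m : nat} (f : 'rV[R]_n -> 'rV[R]_m)
    (i : 'I_m) : 'rV[R]_n -> R :=
  fun z => f z 0 i.

Definition ellc_field {R : realType} {n m : nat} (D : set 'rV[R]_n)
    (f : 'rV[R]_n -> 'rV[R]_m) : Prop :=
  forall i, ellc D (component f i).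

Definition clarke_bounds {R : realType} {n m : nat} (D : set 'rV[R]_n)
    (f : 'rV[R]_n -> 'rV[R]_m) (a b : 'I_m -> 'I_n -> \bar R) : Prop :=
  forall i j,
    [/\ a i j != +oo%E, b i j != -oo%E, ~ (a i j = -oo%E /\ b i j = +oo%E) &
        forall z, D z ->
          (a i j <= clarke_lower D (component f i) z j)%E /\
          (clarke_upper D (component f i) z j <= b i j)%E].

Inductive time := DT | CT.

(* z = (x, w) with x in R^nx and w in R^nw, so that n_z = nx + nw; the i-th
   coordinate of x is the coordinate lshift nw i of z. *)
Section remainder_form.
Context {R : realType} {nx nw : nat}.
Variables (tm : time) (f : 'rV[R]_(nx + nw) -> 'rV[R]_nx).
Variables (a b : 'I_nx -> 'I_(nx + nw) -> \bar R).
(* In continuous time, x 0 i is the value at which the i-th coordinate of the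
   argument is fixed in the i-th component; x is not used in discrete time. *)
Variable x : 'rV[R]_nx.
Implicit Types (i : 'I_nx) (j : 'I_(nx + nw)) (m z zh : 'rV[R]_(nx + nw)).
Implicit Types (V : ivec R (nx + nw)).

Definition frozen i j : bool := if tm is CT then j == lshift nw i else false.

Definition freeze i z : 'rV[R]_(nx + nw) :=
  \row_j if frozen i j then x 0 i else z 0 j.

Definition freeze_ivec i V : ivec R (nx + nw) := (freeze i V.1, freeze i V.2).

Definition pbound i j : \bar R := Order.min (a i j) 0%E.

Definition rbound i j : \bar R := Order.max (b i j) 0%E.

(* The infinite values of pbound and rbound select no vector. *)
Definition slopes i : set 'rV[R]_(nx + nw) :=
  [set m | forall j, if frozen i j then m 0 j = 0
                     else (m 0 j)%:E = rbound i j \/ (m 0 j)%:E = pbound i j].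

Definition corner i m z zh : 'rV[R]_(nx + nw) :=
  freeze i (\row_j if (rbound i j <= (m 0 j)%:E)%E then zh 0 j else z 0 j).

Definition corner_pos V i m := corner i m V.2 V.1.

Definition corner_neg V i m := corner i m V.1 V.2.

Definition Delta1 V i m : R :=
  f (corner_pos V i m) 0 i + dotv m (corner_neg V i m - corner_pos V i m).

Definition Delta2 V i m : R :=
  f (corner_neg V i m) 0 i - dotv m (corner_neg V i m - corner_pos V i m).

Definition upper_R V i : R := inf [set Delta1 V i m | m in slopes i].

Definition lower_R V i : R := sup [set Delta2 V i m | m in slopes i].

Definition T_R V : ivec R nx := (\row_i lower_R V i, \row_i upper_R V i).

Definition upper_true V i : R :=
  sup [set f z 0 i | z in points (freeze_ivec i V)].

Definition lower_true V i : R :=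
  inf [set f z 0 i | z in points (freeze_ivec i V)].

Definition T_O V : ivec R nx := (\row_i lower_true V i, \row_i upper_true V i).

Definition q_lower V : R :=
  sup (range (fun i =>
    Num.max (upper_R V i - upper_true V i) (lower_true V i - lower_R V i))).

End remainder_form.

Arguments T_O {R nx nw} tm f x V.

(* The fixed values of the continuous-time case are taken in the domain. *)
Definition admissible {R : realType} {nx nw : nat} (tm : time)
    (I : 'I_(nx + nw) -> interval R) (x : 'rV[R]_nx) : Prop :=
  tm = CT -> forall i, x 0 i \in I (lshift nw i).

(* Main.v *)
(* Since the Clarke quotients let the base point vary, a bound on the upper
   (lower) Clarke derivative holds up to epsilon for all short increments near
   each point, and by compactness of segments it bounds every increment of f_i
   along e_j that stays in the box.  Hence, for m in M_i^c, f_i - <m, .> is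
   monotone in each coordinate and is largest (smallest) on the interval at the
   positive (negative) corner, which gives
     Delta^2 <= f_i <= Delta^1  on the interval.
   As f_i is attained at both corners, Delta^1 and Delta^2 differ from the true
   extrema by at most <m, zeta^- - zeta^+> <= (sum_j |m_j|) d(IZ).  The constant
   does not depend on the interval, so on a subdivision the same estimate holds
   on each cell with d(IZ) / k and passes to the enclosing intervals. *)

Require Import Defs.
From HB Require Import structures.
From mathcomp Require Import all_boot all_order all_algebra.
From mathcomp Require Import all_classical all_reals all_analysis.
From mathcomp Require Import ring lra.

Import Order.TTheory GRing.Theory Num.Theory.
Import numFieldNormedType.Exports.

Local Open Scope classical_set_scope.
Local Open Scope ring_scope.

(** * Clarke bounds and increments along a coordinate direction *)

(** Compactness of the segment replaces the local thresholds on [h] by a single one; equal steps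
    shorter than it are then summed from 0 to [l]. *)
Lemma slope_le_of_local {R : realType} (g : R -> R) (l c : R) : 0 <= l ->
  (forall s, 0 <= s <= l -> \forall t \near s & h \near 0^'+,
     0 <= t -> t + h <= l -> g (t + h) - g t <= c * h) ->
  g l - g 0 <= c * l.
Proof.
move=> l0 loc.
have : near_covering `[0, l] by apply/compact_near_coveringP/segment_compact.
move=> /(_ R 0^'+ (fun h t => 0 <= t -> t + h <= l -> g (t + h) - g t <= c * h)).
move=> /(_ _)[|e /= e0 small].
  by move=> s; rewrite /= in_itv; exact: loc.
have [l_eq0|l_neq0] := eqVneq l 0; first by rewrite l_eq0 subrr mulr0.
have l_gt0 : 0 < l by rewrite lt_neqAle eq_sym l_neq0.
(* With more than [l / e] steps, the step length [l / n] falls below the uniform threshold [e]. *)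
have [n n_big] : exists n : nat, l / e < n%:R.
  by exists (Num.bound (l / e)); apply: archi_boundP; rewrite divr_ge0// ltW.
have n_gt0 : 0 < n%:R :> R by apply: le_lt_trans n_big; rewrite divr_ge0// ltW.
pose h := l / n%:R.
have h_gt0 : 0 < h by rewrite divr_gt0.
have hle : h < e by rewrite /h ltr_pdivrMr// mulrC -ltr_pdivrMr.
have hn : n%:R * h = l by rewrite /h mulrC divfK// gt_eqF.
have step k : (k <= n)%N -> g (k%:R * h) - g 0 <= c * (k%:R * h).
  elim: k => [|k IH kn]; first by rewrite !mul0r subrr mulr0.
  have kh_ge0 : 0 <= k%:R * h by rewrite mulr_ge0// ltW.
  have kh1_le : k%:R * h + h <= l.
    by rewrite -[X in _ + X]mul1r -mulrDl natr1 -hn ler_pM2r// ler_nat.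
  have h_ball : ball 0 e h by rewrite /ball/= sub0r normrN gtr0_norm.
  have kh_itv : `[0, l]%classic (k%:R * h).
    by rewrite /= in_itv/= kh_ge0 (le_trans _ kh1_le)// lerDl ltW.
  have := small h h_ball h_gt0 _ kh_itv kh_ge0 kh1_le.
  have := IH (ltnW kn).
  by rewrite -natr1 mulrDl mul1r mulrDr; lra.
by have := step n (leqnn n); rewrite hn.
Qed.

(** Pulls neighbourhoods in the space of pairs (base point, increment), where the Clarke filter
    lives, back to a line, where the segment argument runs. *)
Lemma near_line {R : realType} {n : nat} (P : set ('rV[R]_n * R))
    (z e : 'rV[R]_n) (s : R) : nbhs (z + s *: e, 0) P ->
  \forall t \near s & h \near 0^'+, P (z + t *: e, h).
Proof.
move=> nP.
have line_cont : (z + x.1 *: e, x.2) @[x --> (s, 0 : R)] --> (z + s *: e, 0 : R).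
  have fst_cont : z + x.1 *: e @[x --> (s, 0 : R)] --> z + s *: e.
    by apply: cvgD; [exact: cvg_cst|apply: cvgZr_tmp; exact: cvg_fst].
  have snd_cont : x.2 @[x --> (s, 0 : R)] --> (0 : R) by exact: cvg_snd.
  exact: (cvg_pair fst_cont snd_cont).
have [[A B] [/= sA B0] AB] := line_cont P nP.
exists (A, B) => //=; split => //.
by apply: cvg_within.
Qed.

Lemma clarke_upper_slope {R : realType} {n : nat} (D : set 'rV[R]_n)
    (phi : 'rV[R]_n -> R) (j : 'I_n) (c l : R) (z : 'rV[R]_n) :
  0 <= l -> (forall t, 0 <= t <= l -> D (z + t *: delta_mx 0 j)) ->
  (forall w, D w -> (clarke_upper D phi w j <= c%:E)%E) ->
  phi (z + l *: delta_mx 0 j) - phi z <= c * l.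
Proof.
move=> l0 Dz upper.
have [l_eq0|l_neq0] := eqVneq l 0; first by rewrite l_eq0 scale0r addr0 subrr mulr0.
have l_gt0 : 0 < l by rewrite lt_neqAle eq_sym l_neq0.
apply/ler_addgt0Pr => eps eps0.
(* The slack [eps / l] in the slope costs [eps] over the whole segment. It makes the bound on the
   limsup strict, so that some set of the filter has all its quotients below [c + eps / l]. *)
have -> : c * l + eps = (c + eps / l) * l by rewrite mulrDl divfK.
have c_lt : c < c + eps / l by rewrite ltrDl divr_gt0.
pose g t := phi (z + t *: delta_mx 0 j).
rewrite -/(g l) (_ : phi z = g 0); last by rewrite /g scale0r addr0.
apply: slope_le_of_local => // s s_itv.
have : (clarke_upper D phi (z + s *: delta_mx 0 j)%R j < (c + eps / l)%:E)%E.
  by apply: le_lt_trans (upper _ (Dz _ s_itv)) _; rewrite lte_fin.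
move=> /ereal_inf_lt[_ [A nearA <-]] supA.
have := near_line _ _ _ _ nearA.
move=> [[U V] [/= sU V0] UV]; exists (U, V `&` [set h | 0 < h]) => /=.
  by split=> //; apply: filterI => //; exact: nbhs_right_gt.
move=> [t h] [/= Ut [Vh h0]] t0 thl.
have zthE : z + t *: delta_mx 0 j + h *: delta_mx 0 j =
            z + (t + h) *: delta_mx 0 j :> 'rV[R]_n.
  by rewrite -addrA -scalerDl.
(* The filter only sees quotients with both points in [D]; here both lie on the segment because [t]
   and [t + h] stay in [0, l]. *)
have Ath : A (z + t *: delta_mx 0 j, h).
  apply: (UV (t, h)) => //=; split => //; last first.
    by rewrite zthE; apply: Dz; rewrite thl addr_ge0// ltW.
  by apply: Dz; rewrite t0 (le_trans _ thl)// lerDl ltW.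
have : (diff_quotient phi j (z + t *: delta_mx 0 j, h)%R <= (c + eps / l)%:E)%E.
  by apply/ltW/(le_lt_trans _ supA)/ereal_sup_ubound; exists (z + t *: delta_mx 0 j, h).
by rewrite /diff_quotient/= zthE lee_fin ler_pdivrMr.
Qed.

(** The upper case applied to [- phi], whose limsup is minus the liminf of the quotients of
    [phi]. *)
Lemma clarke_lower_slope {R : realType} {n : nat} (D : set 'rV[R]_n)
    (phi : 'rV[R]_n -> R) (j : 'I_n) (c l : R) (z : 'rV[R]_n) :
  0 <= l -> (forall t, 0 <= t <= l -> D (z + t *: delta_mx 0 j)) ->
  (forall w, D w -> (c%:E <= clarke_lower D phi w j)%E) ->
  c * l <= phi (z + l *: delta_mx 0 j) - phi z.
Proof.
move=> l0 Dz lower.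
have dqN : diff_quotient (\- phi) j = (\- diff_quotient phi j)%E.
  by apply/funext => p; rewrite /diff_quotient/= -mulNr opprB addrC opprK.
have := @clarke_upper_slope _ _ D (\- phi) j (- c) l z l0 Dz.
rewrite mulNr opprK addrC => H; rewrite -lerN2 opprB; apply: H => w Dw.
by rewrite /clarke_upper dqN limf_esupN EFinN leeN2; exact: lower.
Qed.

(** * Increments between two points of a box *)

Lemma dotvE {R : realType} {n : nat} (m u v : 'rV[R]_n) :
  dotv m (u - v) = \sum_j m 0 j * (u 0 j - v 0 j).
Proof. by apply: eq_bigr => j _; rewrite !mxE. Qed.

(* Telescoping along the path from v to u that changes one coordinate at a
   time. *)
Lemma increment_le_of_coordinates {R : realType} {n : nat}
    (phi : 'rV[R]_n -> R) (m u v : 'rV[R]_n) :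
  (forall j (w : 'rV[R]_n),
     (forall k, w 0 k = u 0 k \/ w 0 k = v 0 k) -> w 0 j = v 0 j ->
     phi (w + (u 0 j - v 0 j) *: delta_mx 0 j) - phi w
       <= m 0 j * (u 0 j - v 0 j)) ->
  phi u - phi v <= dotv m (u - v).
Proof.
move=> step.
pose w (k : nat) : 'rV[R]_n := \row_j if (j < k)%N then u 0 j else v 0 j.
have wn : w n = u by apply/rowP => j; rewrite mxE ltn_ord.
have w0 : w 0%N = v by apply/rowP => j; rewrite mxE ltn0.
have -> : phi u - phi v = \sum_(0 <= k < n) (phi (w k.+1) - phi (w k)).
  by rewrite (telescope_sumr (phi \o w)) //= wn w0.
rewrite big_mkord dotvE; apply: ler_sum => j _.
have -> : w j.+1 = w j + (u 0 j - v 0 j) *: delta_mx 0 j.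
  apply/rowP => k; rewrite !mxE ltnS leq_eqVlt eqxx /= -val_eqE/=.
  have [/val_inj->|_] := eqVneq (k : nat) j.
    by rewrite ltnn mulr1 addrC subrK.
  by rewrite mulr0 addr0.
apply: step; last by rewrite mxE ltnn.
by move=> k; rewrite mxE; case: ifP => _; [left|right].
Qed.

Lemma box_line {R : realType} {n : nat} (I : 'I_n -> interval R)
    (z : 'rV[R]_n) (j : 'I_n) (l : R) :
  box I z -> box I (z + l *: delta_mx 0 j) ->
  forall t, 0 <= t <= l -> box I (z + t *: delta_mx 0 j).
Proof.
move=> Dz Dzl t /andP[t0 tl] k.
have := Dzl k; rewrite !mxE => zl.
apply: (@interval_is_interval _ (I k) _ _ (Dz k) zl).
by rewrite lerDl lerD2l ler_wpM2r ?mulr_ge0 ?ler0n.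
Qed.

(** Each coordinate is moved separately. A coordinate that increases from [v] to [u] uses the upper
    Clarke bound, one that decreases uses the lower bound; intermediate points stay in the box
    because it is a product. *)
Lemma increment_le {R : realType} {n : nat} (I : 'I_n -> interval R)
    (phi : 'rV[R]_n -> R) (m u v : 'rV[R]_n) :
  box I u -> box I v ->
  (forall j, [\/ u 0 j = v 0 j,
      v 0 j <= u 0 j /\
        forall w, box I w -> (clarke_upper (box I) phi w j <= (m 0 j)%:E)%E |
      u 0 j <= v 0 j /\
        forall w, box I w -> ((m 0 j)%:E <= clarke_lower (box I) phi w j)%E]) ->
  phi u - phi v <= dotv m (u - v).
Proof.
move=> Du Dv dir; apply: increment_le_of_coordinates => j w w_uv wj.
have Dw : box I w by move=> k; case: (w_uv k) => ->; [exact: Du|exact: Dv].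
set w' := w + _.
have Dw' : box I w'.
  move=> k; rewrite !mxE eqxx /=.
  have [->|_] := eqVneq k j; first by rewrite wj mulr1 addrC subrK; exact: Du.
  by rewrite mulr0 addr0; exact: Dw.
have wE : w = w' + (v 0 j - u 0 j) *: delta_mx 0 j.
  by rewrite /w' -addrA -scalerDl addrA subrK subrr scale0r addr0.
case: (dir j) => [uv|[vu upper]|[uv lower]].
- by rewrite /w' uv subrr scale0r addr0 subrr mulr0.
- apply: (@clarke_upper_slope _ _ (box I)) => //; first by rewrite subr_ge0.
  exact: box_line.
(* The coordinate decreases, so the step is read backwards, as an increment from [w'] up to [w]. *)
- rewrite -lerN2 -mulrN !opprB {1}wE.
  apply: (@clarke_lower_slope _ _ (box I)) => //; first by rewrite subr_ge0.
  by apply: box_line => //; rewrite -wE.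
Qed.

(** * Interval distance, cells and widths *)

Lemma idist_le {R : realType} {n : nat} (V W : ivec R n) (e : R) : 0 <= e ->
  (forall i, `|V.1 0 i - W.1 0 i| <= e /\ `|V.2 0 i - W.2 0 i| <= e) ->
  idist V W <= e.
Proof.
move=> e0 VW; rewrite /idist.
set A := (X in sup X).
(* For [n = 0] the family is empty and its sup is 0 by convention, which [e0] covers. *)
have [->|A0] := eqVneq A set0; first by rewrite sup0.
apply: ge_sup; first exact/set0P.
by move=> _ [i _ <-]; have [V1 V2] := VW i; rewrite ge_max V2 V1.
Qed.

(** Compares two enclosing intervals: the inclusion fixes the signs of the differences, the
    approximation of points of [A] by points of [B] bounds their size. *)
Lemma sup_inf_dist_le {R : realType} (A B : set R) (e : R) :
  B !=set0 -> B `<=` A -> has_ubound A -> has_lbound A ->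
  (forall y, A y -> exists2 y', B y' & `|y - y'| <= e) ->
  `|inf A - inf B| <= e /\ `|sup A - sup B| <= e.
Proof.
move=> B0 BA ubA lbA near_B.
have A0 : A !=set0 by case: B0 => y By; exists y; exact: BA.
have ubB : has_ubound B by case: ubA => M AM; exists M => y /BA/AM.
have lbB : has_lbound B by case: lbA => M AM; exists M => y /BA/AM.
have infAB : inf A <= inf B by apply: lb_le_inf => // y /BA; exact: ge_inf.
have supBA : sup B <= sup A by apply: ge_sup => // y /BA; exact: ub_le_sup.
split.
  rewrite distrC ger0_norm ?subr_ge0// lerBlDr -lerBlDl; apply: lb_le_inf => // y /near_B.
  move=> [y' By']; rewrite ler_norml => /andP[ye _].
  by have := ge_inf lbB By'; lra.
rewrite ger0_norm ?subr_ge0// lerBlDr; apply: ge_sup => // y /near_B.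
move=> [y' By']; rewrite ler_norml => /andP[_ ye].
by have := ub_le_sup ubB By'; lra.
Qed.

Lemma cell_in {R : realType} {n : nat} (k : nat) (V : ivec R n)
    (l : {ffun 'I_n -> 'I_k}) : proper_ivec V -> forall j,
  [/\ V.1 0 j <= (cell V l).1 0 j, (cell V l).1 0 j <= (cell V l).2 0 j &
      (cell V l).2 0 j <= V.2 0 j].
Proof.
move=> V12 j; rewrite !mxE.
have k0 : (0 < k)%N by apply: leq_ltn_trans (ltn_ord (l j)).
have V0 : 0 <= (V.2 0 j - V.1 0 j) / k%:R by rewrite divr_ge0// subr_ge0.
split.
- by rewrite lerDl mulr_ge0.
- by rewrite lerD2l ler_wpM2r// ler_nat.
rewrite -lerBrDl; apply: (@le_trans _ _ (k%:R * ((V.2 0 j - V.1 0 j) / k%:R))).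
  by rewrite ler_wpM2r// ler_nat.
by rewrite mulrC divfK// pnatr_eq0 -lt0n.
Qed.

Lemma width_cell {R : realType} {n : nat} (k : nat) (V : ivec R n)
    (l : {ffun 'I_n -> 'I_k}) : width (cell V l) = width V / k%:R.
Proof.
rewrite /width (_ : _ - _ = k%:R^-1 *: (V.2 - V.1)); last first.
  by apply/rowP => j; rewrite !mxE -natr1; ring.
by rewrite normrZ ger0_norm ?invr_ge0// mulrC.
Qed.

Lemma width_ge0 {R : realType} {n : nat} (V : ivec R n) : 0 <= width V.
Proof. exact: normr_ge0. Qed.

Lemma ler_entry_width {R : realType} {n : nat} (V : ivec R n) (j : 'I_n) :
  `|V.2 0 j - V.1 0 j| <= width V.
Proof.
rewrite /width -[`|V.2 - V.1|]/(mx_norm (V.2 - V.1)) mx_normrE.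
have := le_bigmax (0 : R) (fun ij => `|(V.2 - V.1) ij.1 ij.2|) (ord0, j).
by rewrite /= !mxE.
Qed.

Lemma norm_dotv_le {R : realType} {n : nat} (m v : 'rV[R]_n) (w : R)
    (M : 'I_n -> R) :
  (forall j, `|m 0 j| <= M j) -> (forall j, `|v 0 j| <= w) ->
  `|dotv m v| <= (\sum_j M j) * w.
Proof.
move=> mM vw; rewrite mulr_suml; apply: le_trans (ler_norm_sum _ _ _) _.
by apply: ler_sum => j _; rewrite normrM ler_pM.
Qed.

(** * Enclosure of the true range by the remainder form *)

Section remainder_bounds.
Context {R : realType} {nx nw : nat} (tm : time).
Context (I : 'I_(nx + nw) -> interval R) (f : 'rV[R]_(nx + nw) -> 'rV[R]_nx).
Context (a b : 'I_nx -> 'I_(nx + nw) -> \bar R) (x : 'rV[R]_nx).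
Hypothesis f_bounds : clarke_bounds (box I) f a b.
Hypothesis x_adm : admissible tm I x.
Implicit Types (i : 'I_nx) (m z u v : 'rV[R]_(nx + nw)).
Implicit Types (V W : ivec R (nx + nw)).

Local Notation D := (box I).
Local Notation fr := (frozen tm).
Local Notation S := (slopes tm a b).
Local Notation cpos := (corner_pos tm b x).
Local Notation cneg := (corner_neg tm b x).
Local Notation D1 := (Delta1 tm f b x).
Local Notation D2 := (Delta2 tm f b x).
Local Notation fV := (freeze_ivec tm x).

(** The test used by [corner] tells the two kinds of slope apart: if it holds, m_j dominates
    max(b_ij, 0); if it fails, m_j can only be min(a_ij, 0). Ties fall in the first case. *)
Lemma slope_direction i m j : S i m -> ~~ fr i j ->
  if (rbound b i j <= (m 0 j)%:E)%E
  then 0 <= m 0 j /\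
       forall w, D w -> (clarke_upper D (component f i) w j <= (m 0 j)%:E)%E
  else m 0 j <= 0 /\
       forall w, D w -> ((m 0 j)%:E <= clarke_lower D (component f i) w j)%E.
Proof.
move=> Sm /negbTE nfr; have [_ _ _ bnd] := f_bounds i j.
have := Sm j; rewrite nfr => mE.
case: ifPn => [rm|nrm].
  split=> [|w Dw]; first by rewrite -lee_fin (le_trans _ rm)// le_max lexx orbT.
  have [_ ub] := bnd w Dw; apply: (le_trans ub); apply: le_trans rm.
  by rewrite le_max lexx.
case: mE => [mr|mp]; first by rewrite mr lexx in nrm.
split=> [|w Dw]; first by rewrite -lee_fin mp ge_min lexx orbT.
have [lb _] := bnd w Dw; apply: le_trans lb.
by rewrite mp ge_min lexx.
Qed.

(** Of a_ij and b_ij at least one is finite, so each coordinate has a real value to choose. Hence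
    the inf and sup over slopes are not taken over an empty family. *)
Lemma slopes_neq0 i : S i !=set0.
Proof.
exists (\row_j if fr i j then 0
               else if b i j == +oo%E then fine (pbound a i j)
               else fine (rbound b i j)) => j.
rewrite mxE; case: (fr i j) => //.
have [a_ltoo b_gtoo ab _] := f_bounds i j.
case: ifPn => [/eqP boo|bnoo].
  right; rewrite fineK// /pbound.
  rewrite minEle; case: ifP => // _; rewrite fin_numE a_ltoo andbT.
  by apply/eqP => aoo; apply: ab.
left; rewrite fineK// /rbound.
by rewrite maxEle; case: ifP => // _; rewrite fin_numE b_gtoo bnoo.
Qed.

(** Bounds the sum of |m_j| over all slope vectors, independently of the interval. [fine] sends an
    infinite bound to 0, which is harmless because a real slope can only equal a finite one. *)
Definition slope_bound i : R :=
  \sum_j (`|fine (rbound b i j)| + `|fine (pbound a i j)|).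

Lemma slope_le i m j : S i m ->
  `|m 0 j| <= `|fine (rbound b i j)| + `|fine (pbound a i j)|.
Proof.
move=> /(_ j); case: ifP => _; first by move=> ->; rewrite normr0 addr_ge0.
by case=> <-; rewrite /= ?lerDl ?lerDr.
Qed.

(** The fixed value x_i may lie outside the i-th side of [V]; admissibility still keeps it in the
    domain. *)
Lemma freeze_sub V : proper_ivec V -> points V `<=` D ->
  forall i, points (fV i V) `<=` D.
Proof.
move=> V12 VD i z zV j.
have D1 : D V.1 by apply: VD => k; rewrite lexx V12.
have D2 : D V.2 by apply: VD => k; rewrite lexx V12.
have := zV j; rewrite !mxE; case: ifPn => [frj|_ zj]; last first.
  exact: (@interval_is_interval _ (I j) _ _ (D1 j) (D2 j)).
rewrite -eq_le => /eqP <-.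
by move: x_adm frj; rewrite /admissible /frozen; case: tm => // + /eqP ->; exact.
Qed.

Lemma corner_in V i m : proper_ivec V ->
  points (fV i V) (cpos V i m) /\ points (fV i V) (cneg V i m).
Proof.
move=> V12; split=> j; rewrite !mxE; case: ifP => _; rewrite ?lexx//;
  by case: ifP => _; rewrite lexx V12.
Qed.

(** Common core of both enclosures, with (u, v) = (z, positive corner) and (negative corner, z).
    Each u_j - v_j has the sign of m_j and is at most as long as the step between the corners, so
    passing to the corners can only enlarge each term m_j (u_j - v_j). *)
Lemma corner_increment V i m u v : S i m -> D u -> D v ->
  (forall j, if fr i j then u 0 j = v 0 j
             else if (rbound b i j <= (m 0 j)%:E)%E
                  then 0 <= u 0 j - v 0 j <= V.2 0 j - V.1 0 j
                  else V.1 0 j - V.2 0 j <= u 0 j - v 0 j <= 0) ->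
  f u 0 i - f v 0 i <= dotv m (cneg V i m - cpos V i m).
Proof.
move=> Sm Du Dv uv.
apply: (@le_trans _ _ (dotv m (u - v))).
  apply: (@increment_le _ _ I (component f i)) => // j.
  have := uv j; have := @slope_direction i m j Sm.
  case: (fr i j) => [_ ->|/(_ isT)]; first exact: Or31.
  case: (_ <= _)%E => [[_ ub] /andP[uv0 _]|[_ lb] /andP[_ uv0]].
    by apply: Or32; rewrite -subr_ge0.
  by apply: Or33; rewrite -subr_le0.
rewrite !dotvE; apply: ler_sum => j _; rewrite !mxE.
have := uv j; have := @slope_direction i m j Sm.
case: (fr i j) => [_ ->|/(_ isT)]; first by rewrite !subrr.
case: (_ <= _)%E => [[m0 _] /andP[_ le]|[m0 _] /andP[le _]].
  exact: ler_wpM2l.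
exact: ler_wnM2l.
Qed.

Lemma le_Delta1 V i m z : proper_ivec V -> points V `<=` D -> S i m ->
  points (fV i V) z -> f z 0 i <= D1 V i m.
Proof.
move=> V12 VD Sm zV; rewrite /Delta1 -lerBlDl.
have fVD := freeze_sub V V12 VD i; have [cp cn] := corner_in V i m V12.
apply: corner_increment => //; [exact: fVD|exact: fVD|move=> j].
have := zV j; rewrite !mxE; case: (fr i j).
  by rewrite -eq_le => /eqP.
by case: (_ <= _)%E => /andP[z1 z2]; apply/andP; split; lra.
Qed.

Lemma Delta2_le V i m z : proper_ivec V -> points V `<=` D -> S i m ->
  points (fV i V) z -> D2 V i m <= f z 0 i.
Proof.
move=> V12 VD Sm zV; rewrite /Delta2 lerBlDr -lerBlDl.
have fVD := freeze_sub V V12 VD i; have [cp cn] := corner_in V i m V12.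
apply: corner_increment => //; [exact: fVD|exact: fVD|move=> j].
have := zV j; rewrite !mxE; case: (fr i j).
  by rewrite -eq_le => /eqP.
by case: (_ <= _)%E => /andP[z1 z2]; apply/andP; split; lra.
Qed.

Lemma slope_term_le V i m : S i m ->
  `|dotv m (cneg V i m - cpos V i m)| <= slope_bound i * width V.
Proof.
move=> Sm; apply: norm_dotv_le => j; first exact: slope_le.
have := ler_entry_width V j; rewrite !mxE.
case: ifP => _; first by rewrite subrr normr0; exact: le_trans.
by case: ifP => _ //; rewrite distrC.
Qed.

(** A single slope vector already gives finite bounds through its [Delta1] and [Delta2]. *)
Lemma true_bounded V i : proper_ivec V -> points V `<=` D ->
  has_ubound [set f z 0 i | z in points (fV i V)] /\
  has_lbound [set f z 0 i | z in points (fV i V)].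
Proof.
move=> V12 VD; have [m Sm] := slopes_neq0 i.
split; [exists (D1 V i m)|exists (D2 V i m)] => _ [z zV <-].
  exact: le_Delta1.
exact: Delta2_le.
Qed.

Lemma le_true V i z : proper_ivec V -> points V `<=` D -> points (fV i V) z ->
  lower_true tm f x V i <= f z 0 i <= upper_true tm f x V i.
Proof.
move=> V12 VD zV; have [ub lb] := true_bounded V i V12 VD.
by rewrite ge_inf ?ub_le_sup//; exists z.
Qed.

(** Every [Delta1] dominates the true supremum. Conversely the infimum is at most one chosen
    [Delta1], whose function value is taken at a corner of the interval and so cannot exceed that
    supremum. *)
Lemma upper_R_bounds V i : proper_ivec V -> points V `<=` D ->
  upper_true tm f x V i <= upper_R tm f a b x V i
    <= upper_true tm f x V i + slope_bound i * width V.
Proof.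
move=> V12 VD; have [m Sm] := slopes_neq0 i.
have [cp cn] := corner_in V i m V12.
have le12 m' : S i m' -> upper_true tm f x V i <= D1 V i m'.
  move=> Sm'; apply: ge_sup; first by exists (f (cpos V i m) 0 i); exists (cpos V i m).
  by move=> _ [z zV <-]; exact: le_Delta1.
apply/andP; split.
  apply: lb_le_inf; first by exists (D1 V i m); exists m.
  by move=> _ [m' Sm' <-]; exact: le12.
apply: (@le_trans _ _ (D1 V i m)).
  apply: ge_inf; last by exists m.
  by exists (upper_true tm f x V i) => _ [m' Sm' <-]; exact: le12.
rewrite /Delta1 lerD//; first by have /andP[] := le_true V i _ V12 VD cp.
exact: le_trans (ler_norm _) (slope_term_le V i m Sm).
Qed.

Lemma lower_R_bounds V i : proper_ivec V -> points V `<=` D ->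
  lower_true tm f x V i - slope_bound i * width V
    <= lower_R tm f a b x V i <= lower_true tm f x V i.
Proof.
move=> V12 VD; have [m Sm] := slopes_neq0 i.
have [cp cn] := corner_in V i m V12.
have le21 m' : S i m' -> D2 V i m' <= lower_true tm f x V i.
  move=> Sm'; apply: lb_le_inf; first by exists (f (cneg V i m) 0 i); exists (cneg V i m).
  by move=> _ [z zV <-]; exact: Delta2_le.
apply/andP; split; last first.
  apply: ge_sup; first by exists (D2 V i m); exists m.
  by move=> _ [m' Sm' <-]; exact: le21.
apply: (@le_trans _ _ (D2 V i m)); last first.
  apply: ub_le_sup; last by exists m.
  by exists (lower_true tm f x V i) => _ [m' Sm' <-]; exact: le21.
rewrite /Delta2 lerB//; first by have /andP[] := le_true V i _ V12 VD cn.
exact: le_trans (ler_norm _) (slope_term_le V i m Sm).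
Qed.

(** * Linear convergence with a uniform constant *)

Let K : R := \sum_i slope_bound i.

Lemma slope_bound_ge0 i : 0 <= slope_bound i.
Proof. by apply: sumr_ge0 => j _; rewrite addr_ge0. Qed.

Let K_ge0 : 0 <= K.
Proof. by apply: sumr_ge0 => i _; apply: (slope_bound_ge0 i). Qed.

Lemma slope_bound_le i V : slope_bound i * width V <= K * width V.
Proof.
rewrite ler_wpM2r ?width_ge0// /K (bigD1 i)//= lerDl.
by apply: sumr_ge0 => j _; exact: slope_bound_ge0.
Qed.

(** By the enclosure both differences are nonnegative, so the absolute values in the metric
    disappear. *)
Lemma q_lowerE V : proper_ivec V -> points V `<=` D ->
  q_lower tm f a b x V = idist (T_R tm f a b x V) (T_O tm f x V).
Proof.
move=> V12 VD; rewrite /q_lower /idist; congr (sup _).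
apply: eq_imagel => i _; rewrite /= !mxE.
have /andP[u1 _] := upper_R_bounds V i V12 VD.
have /andP[_ l1] := lower_R_bounds V i V12 VD.
by rewrite ger0_norm ?subr_ge0// (distrC (lower_R _ _ _ _ _ _ _)) ger0_norm ?subr_ge0.
Qed.

Lemma idist_T_le V : proper_ivec V -> points V `<=` D ->
  idist (T_R tm f a b x V) (T_O tm f x V) <= K * width V.
Proof.
move=> V12 VD; apply: idist_le.
  by rewrite mulr_ge0 ?K_ge0 ?width_ge0.
move=> i; rewrite !mxE.
have /andP[u1 u2] := upper_R_bounds V i V12 VD.
have /andP[l2 l1] := lower_R_bounds V i V12 VD.
have := slope_bound_le i V => KV.
by rewrite distrC !ger0_norm ?subr_ge0//; split; lra.
Qed.

(** * The subdivision estimate *)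

Lemma freeze_points_sub V W i :
  (forall j, V.1 0 j <= W.1 0 j /\ W.2 0 j <= V.2 0 j) ->
  points (fV i W) `<=` points (fV i V).
Proof.
move=> VW z zW j; have [V1 V2] := VW j.
have := zW j; rewrite !mxE; case: (fr i j) => // /andP[W1 W2].
by rewrite (le_trans V1 W1) (le_trans W2 V2).
Qed.

(** Applied to cells, this bounds the unions over all cells by data of [V] alone. *)
Lemma true_sub V W i : proper_ivec V -> points V `<=` D -> proper_ivec W ->
  (forall j, V.1 0 j <= W.1 0 j /\ W.2 0 j <= V.2 0 j) ->
  [/\ lower_true tm f x V i <= lower_true tm f x W i,
      lower_true tm f x W i <= upper_true tm f x W i &
      upper_true tm f x W i <= upper_true tm f x V i].
Proof.
move=> V12 VD W12 VW.
have WD : points W `<=` D.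
  move=> z zW; apply: VD => j; have [V1 V2] := VW j; have /andP[W1 W2] := zW j.
  by rewrite (le_trans V1 W1) (le_trans W2 V2).
have [m _] := slopes_neq0 i; have [cW _] := corner_in W i m W12.
have fW0 : [set f z 0 i | z in points (fV i W)] !=set0.
  by exists (f (cpos W i m) 0 i); exists (cpos W i m).
split.
- apply: lb_le_inf => // _ [z zW <-].
  by have /andP[] := le_true V i z V12 VD (freeze_points_sub V W i VW z zW).
- by have /andP[z1 z2] := le_true W i _ W12 WD cW; exact: le_trans z2.
- apply: ge_sup => // _ [z zW <-].
  by have /andP[] := le_true V i z V12 VD (freeze_points_sub V W i VW z zW).
Qed.

(** On each cell the remainder interval contains the true one and exceeds it by at most [e] at
    either end; both facts survive the union over cells. *)
Lemma idist_subdivided_le V k : proper_ivec V -> points V `<=` D -> (0 < k)%N ->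
  idist (hull (subdivided (T_R tm f a b x) k V))
        (hull (subdivided (T_O tm f x) k V)) <= K * width V / k%:R.
Proof.
move=> V12 VD k0; set e := K * width V / k%:R.
have e0 : 0 <= e by rewrite divr_ge0// mulr_ge0 ?width_ge0.
apply: idist_le => // i; rewrite !mxE.
pose c := @cell R (nx + nw) k V.
have c12 l : proper_ivec (c l) by move=> j; have [] := cell_in k V l V12 j.
have cV l j : V.1 0 j <= (c l).1 0 j /\ (c l).2 0 j <= V.2 0 j.
  by have [] := cell_in k V l V12 j.
have cD l : points (c l) `<=` D.
  move=> z zc; apply: VD => j; have /andP[z1 z2] := zc j; have [V1 V2] := cV l j.
  by rewrite (le_trans V1 z1) (le_trans z2 V2).
have tV l i' := true_sub V (c l) i' V12 VD (c12 l) (cV l).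
have Kc l i' : slope_bound i' * width (c l) <= e.
  by rewrite /e -mulrA -(width_cell k V l); exact: slope_bound_le.
have R_near l i' :
    [/\ lower_true tm f x (c l) i' - e <= lower_R tm f a b x (c l) i',
        lower_R tm f a b x (c l) i' <= lower_true tm f x (c l) i',
        upper_true tm f x (c l) i' <= upper_R tm f a b x (c l) i' &
        upper_R tm f a b x (c l) i' <= upper_true tm f x (c l) i' + e].
  have /andP[u1 u2] := upper_R_bounds (c l) i' (c12 l) (cD l).
  have /andP[l1 l2] := lower_R_bounds (c l) i' (c12 l) (cD l).
  by have Kl := Kc l i'; split=> //; lra.
(* The cell at the lower corner exists because [k] is positive; it shows that the union of true
   ranges is nonempty. *)
pose l0 : {ffun 'I_(nx + nw) -> 'I_k} := [ffun=> Ordinal k0].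
apply: sup_inf_dist_le.
- pose y : 'rV[R]_nx := \row_i' upper_true tm f x (c l0) i'.
  exists (y 0 i); exists y => //; exists l0 => // i'.
  by rewrite !mxE lexx andbT; have [] := tV l0 i'.
- move=> _ [y [l _ yl] <-]; exists y => //; exists l => // i'.
  have := yl i'; rewrite !mxE => /andP[y1 y2].
  by have [_ l1 u1 _] := R_near l i'; rewrite (le_trans l1 y1) (le_trans y2 u1).
- exists (upper_true tm f x V i + e) => _ [y [l _ yl] <-].
  have := yl i; rewrite !mxE => /andP[_ y2].
  by have [_ _ _ u2] := R_near l i; have [_ _ u3] := tV l i; lra.
- exists (lower_true tm f x V i - e) => _ [y [l _ yl] <-].
  have := yl i; rewrite !mxE => /andP[y1 _].
  by have [l1 _ _ _] := R_near l i; have [l3 _ _] := tV l i; lra.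
- move=> _ [y [l _ yl] <-].
  (* [y'] is [y] clamped to the true range of the same cell. All coordinates are clamped, since the
     union consists of whole vectors. *)
  pose y' : 'rV[R]_nx := \row_i' Num.max (lower_true tm f x (c l) i')
                                   (Num.min (upper_true tm f x (c l) i') (y 0 i')).
  exists (y' 0 i).
    exists y' => //; exists l => // i'; rewrite !mxE le_max lexx/= ge_max.
    by rewrite ge_min lexx andbT; have [] := tV l i'.
  have := yl i; rewrite !mxE => /andP[y1 y2].
  have [l1 _ _ u2] := R_near l i; have [_ lu _] := tV l i.
  rewrite ler_norml; apply/andP; split.
    by rewrite maxEle minEle; do 2 case: ifPn; rewrite -?ltNge; lra.
  by rewrite maxEle minEle; do 2 case: ifPn; rewrite -?ltNge; lra.
Qed.

End remainder_bounds.

(** * Convergence rate and subdivision principle *)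

Theorem theorem4 (R : realType) (nx nw : nat) (tm : time)
    (I : 'I_(nx + nw) -> interval R)
    (f : 'rV[R]_(nx + nw) -> 'rV[R]_nx)
    (a b : 'I_nx -> 'I_(nx + nw) -> \bar R)
    (f_ellc : ellc_field (box I) f)
    (f_bounds : clarke_bounds (box I) f a b) :
  (exists beta : R, 0 < beta /\
     forall Z : ivec R (nx + nw), proper_ivec Z -> points Z `<=` box I ->
     forall x : 'rV[R]_nx, admissible tm I x ->
       q_lower tm f a b x Z = idist (T_R tm f a b x Z) (T_O tm f x Z) /\
       idist (T_R tm f a b x Z) (T_O tm f x Z) <= beta * width Z) /\
  (forall Z : ivec R (nx + nw), proper_ivec Z -> points Z `<=` box I ->
   exists gamma : R, 0 < gamma /\
     forall x : 'rV[R]_nx, admissible tm I x ->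
     forall k : nat, (0 < k)%N ->
       idist (hull (subdivided (T_R tm f a b x) k Z))
             (hull (subdivided (T_O tm f x) k Z)) <= gamma / k%:R).
Proof.
set K : R := \sum_i slope_bound a b i.
have K0 : 0 <= K by apply: sumr_ge0 => i _; exact: slope_bound_ge0.
split.
  (* Adding 1 keeps the constant positive when all slope bounds vanish. *)
  exists (K + 1); split=> [|Z Z12 ZD x x_adm]; first by rewrite ltr_wpDl.
  split; first exact: (q_lowerE tm I).
  apply: le_trans (idist_T_le tm I f a b x f_bounds x_adm Z Z12 ZD) _.
  by rewrite ler_wpM2r ?width_ge0// lerDl.
(* The added 1 again ensures positivity, also for an interval of width 0. *)
move=> Z Z12 ZD; exists (K * width Z + 1).
split=> [|x x_adm k k0]; first by rewrite ltr_wpDl// mulr_ge0// width_ge0.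
apply: le_trans (idist_subdivided_le tm I f a b x f_bounds x_adm Z k Z12 ZD k0) _.
by rewrite ler_wpM2r ?invr_ge0// lerDl.
Qed.
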